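(* Consider the fundamental matrix $\mathcal{M}(t,t_0)$ of the linear non-autonomous dynamical system $\dot{\mathbf{x}}=\mathbf{A}(t)\mathbf{x}$, where $\mathbf{x}=\mathbf{x}(t)$ is the $n$-dimensional state vector and $\mathbf{A}=\mathbf{A}(t)$ is a given time-dependent matrix. If $$(\mu_i^{(t,t_0)},\mathbf{w}_i^{(t,t_0)},\mathbf{v}_i^{(t,t_0)}),\qquad i=1,\dots,n,$$ are the eigenvalues, left and right eigenvectors of the fundamental matrix $\mathcal{M}(t,t_0)$, then $\lambda_i^{(t,t_0)}$, $i=1,\dots,n$, such that $$\mu_i^{(t,t_0)}=e^{\lambda_i^{(t,t_0)}},\qquad i=1,\dots,n,$$ are the eigenvalues and $$\phi_i^{(t,t_0)}(\cdot)=\langle \cdot,\mathbf{w}_i^{(t,t_0)}\rangle,\qquad i=1,\dots,n,$$ are the eigenfunctions of the Koopman operator $\mathcal{K}^{(t,t_0)}$. Furthermore, $\mathbf{v}_i^{(t,t_0)}$, $i=1,\dots,n$, are the Koopman modes of the full state observable and the following expansion is valid: $$\mathbf{x}(t)=\mathcal{K}^{(t,t_0)}(\mathbf{x}_0)=\sum_{i=1}^{n}e^{\lambda_i^{(t,t_0)}}\,\phi_i^{(t,t_0)}(\mathbf{x}_0)\,\mathbf{v}_i^{(t,t_0)}.$$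
   Context: The fundamental matrix $\mathcal{M}(t,t_0)$ of $\dot{\mathbf{x}}=\mathbf{A}(t)\mathbf{x}$ is the matrix whose $i$-th column is the solution of this equation for the initial condition $\mathbf{x}(t_0)=\mathbf{e}_i$ (the $i$-th standard basis vector), $i=1,\dots,n$. The solution for the initial condition $\mathbf{x}(t_0)=\mathbf{x}_0$ is then $\mathbf{x}(t)=\mathcal{M}(t,t_0)\mathbf{x}_0$; in the expansion, $\mathbf{x}(t)$ denotes this solution. The Koopman operator family $\mathcal{K}^{(t,t_0)}$ is defined by its action on observables $f=f(\mathbf{x})$ (functions of the state, possibly complex- or vector-valued): $\mathcal{K}^{(t,t_0)}f(\mathbf{x}(t_0))=f(\mathbf{x}(t))$. Non-autonomous Koopman eigenvalues $\lambda^{(t,t_0)}$ and eigenfunctions $\phi^{(t,t_0)}$ are defined by $\mathcal{K}^{(t,t_0)}\phi^{(t,t_0)}=e^{\lambda^{(t,t_0)}}\phi^{(t,t_0)}$; thus the eigenvalue is the exponent $\lambda^{(t,t_0)}$, not $e^{\lambda^{(t,t_0)}}$. The full state observable is $f(\mathbf{x})=\mathbf{x}$, and $\mathcal{K}^{(t,t_0)}(\mathbf{x}_0)$ denotes $\mathcal{K}^{(t,t_0)}$ applied to the full state observable and evaluated at $\mathbf{x}_0$. Its Koopman modes are the vector coefficients in its expansion in the Koopman eigenfunctions. $\langle\cdot,\cdot\rangle$ is the standard inner product on $\mathbb{C}^n$, linear in the first argument. A right eigenvector $\mathbf{v}$ of $\mathcal{M}$ for the eigenvalue $\mu$ is a nonzero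 vector with $\mathcal{M}\mathbf{v}=\mu\mathbf{v}$, and a left eigenvector $\mathbf{w}$ is a nonzero vector with $\mathbf{w}^*\mathcal{M}=\mu\mathbf{w}^*$.
   Formalization: For the Koopman modes and the expansion, the left and right eigenvectors are assumed normalized, ⟨v_i,w_j⟩=δ_ij whenever μ_i=μ_j (false otherwise: rescale v_i); the system is assumed to have a unique solution from t_0 for every initial state. *)

(* Defs.v *)
From HB Require Import structures.
From mathcomp Require Import all_boot all_order all_algebra.
From mathcomp Require Import all_classical all_reals all_analysis.
From mathcomp Require Import complex spectral.

Set Implicit Arguments.
Unset Strict Implicit.
Unset Printing Implicit Defensive.

Import Order.TTheory GRing.Theory Num.Theory.
Import numFieldNormedType.Exports.

Local Open Scope classical_set_scope.
Local Open Scope ring_scope.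
Local Open Scope sesquilinear_scope.

Definition cexp (R : realType) (z : R[i]) : R[i] :=
  Complex (expR (complex.Re z) * cos (complex.Im z))
          (expR (complex.Re z) * sin (complex.Im z)).

Definition complexify (R : realType) (m n : nat) (B : 'M[R]_(m, n)) :
    'M[R[i]]_(m, n) :=
  map_mx (real_complex R) B.

Definition inner (R : realType) (n : nat) (u v : 'cV[R[i]]_n) : R[i] :=
  \sum_(k < n) u k 0 * Num.conj (v k 0).

Definition right_eigenvector (R : realType) (n : nat) (B : 'M[R[i]]_n)
    (mu : R[i]) (v : 'cV[R[i]]_n) : Prop :=
  v != 0 /\ B *m v = mu *: v.

Definition left_eigenvector (R : realType) (n : nat) (B : 'M[R[i]]_n)
    (mu : R[i]) (w : 'cV[R[i]]_n) : Prop :=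
  w != 0 /\ w ^t* *m B = mu *: w ^t*.

Section LinearSystem.
Variables (R : realType) (n : nat) (A : R -> 'M[R]_n).

Definition is_solution (x : R -> 'cV[R]_n) : Prop :=
  forall s : R, is_derive s (1 : R) x (A s *m x s).

Definition solves_from (t0 : R) (x0 : 'cV[R]_n) (x : R -> 'cV[R]_n) : Prop :=
  is_solution x /\ x t0 = x0.

(* Makes "the solution with x(t0) = x0" meaningful; it holds, for instance,
   at every t0 when A is continuous. *)
Definition well_posed (t0 : R) : Prop :=
  forall x0 : 'cV[R]_n, exists! x : R -> 'cV[R]_n, solves_from t0 x0 x.

(* The default value (the zero function) is never used when the system is
   well posed at t0. *)
Definition solution (t0 : R) (x0 : 'cV[R]_n) : R -> 'cV[R]_n :=
  xget (fun=> 0) [set x | solves_from t0 x0 x].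

Definition fundamental_matrix (t t0 : R) : 'M[R]_n :=
  \matrix_(i, j) solution t0 (delta_mx j 0) t i 0.

Definition koopman (V : Type) (t t0 : R) (f : 'cV[R]_n -> V) :
    'cV[R]_n -> V :=
  fun x0 => f (solution t0 x0 t).

(* The eigenvalue is the exponent lambda, not cexp lambda. *)
Definition koopman_eigenpair (t t0 : R) (lambda : R[i])
    (phi : 'cV[R]_n -> R[i]) : Prop :=
  (exists x0, phi x0 != 0) /\
  forall x0, koopman t t0 phi x0 = cexp lambda * phi x0.

Definition koopman_modes (t t0 : R) (m N : nat)
    (f : 'cV[R]_n -> 'cV[R[i]]_m) (lambda : 'I_N -> R[i])
    (phi : 'I_N -> 'cV[R]_n -> R[i]) (v : 'I_N -> 'cV[R[i]]_m) : Prop :=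
  (forall i, koopman_eigenpair t t0 (lambda i) (phi i)) /\
  forall x0, f x0 = \sum_(i < N) phi i x0 *: v i.

End LinearSystem.

(* f(x) = x, the real state being viewed in C^n. *)
Definition full_state (R : realType) (n : nat) : 'cV[R]_n -> 'cV[R[i]]_n :=
  fun x => complexify x.

(* The usual normalization of left against right eigenvectors, imposed only
   within each eigenvalue: for simple eigenvalues it just says <v_i, w_i> = 1,
   and for repeated ones that dual bases of the left and right eigenspaces are
   chosen.  Orthogonality across distinct eigenvalues is not assumed, as it
   follows from the eigenvector equations. *)
Definition normalized_eigenvectors (R : realType) (n : nat)
    (mu : 'I_n -> R[i]) (w v : 'I_n -> 'cV[R[i]]_n) : Prop :=
  forall i j, mu i = mu j -> inner (v i) (w j) = (i == j)%:R.

(* Main.v *)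
Require Import Defs.
From HB Require Import structures.
From mathcomp Require Import all_boot all_order all_algebra.
From mathcomp Require Import all_classical all_reals all_analysis.
From mathcomp Require Import complex spectral.

(** Two facts carry the proof.

    Time evolution is linear.  A linear combination of solutions is a solution,
    so well-posedness forces the solution issued from [x0 = \sum_j x0_j e_j] to
    be [\sum_j x0_j x^(j)], where [x^(j)] is the solution issued from [e_j].  At
    time [t] this reads [x(t) = M(t, t0) x0] ([solution_fundamental_matrix]),
    and the Koopman operator is composition with the linear map [M(t, t0)].
    For a left eigenvector [w] of [M], this gives
    [<M x0, w> = w^* M x0 = mu w^* x0 = mu <x0, w>], so [<., w>] is a Koopman
    eigenfunction for the exponent [lambda] with [e^lambda = mu]; it does not
    vanish identically on the real state space because it takes the value
    [conj (w_k)] at [e_k].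

    Left and right eigenvectors are dual bases.  Since
    [mu_i <v_i, w_j> = <M v_i, w_j> = mu_j <v_i, w_j>], the vectors [v_i] and
    [w_j] are orthogonal whenever [mu_i <> mu_j]; together with the
    normalization inside each eigenvalue this is full biorthogonality, i.e.
    [W V = 1] for the square matrices with rows [w_i^*] and columns [v_i].
    Hence also [V W = 1], which is the resolution of the identity
    [x = \sum_i <x, w_i> v_i] ([biorthogonal_expansion]).  It exhibits the [v_i]
    as the Koopman modes of the full state, and applying [M] to it turns each
    [v_i] into [e^(lambda_i) v_i], which is the expansion of [x(t)]. *)

Set Implicit Arguments.
Unset Strict Implicit.

Import Order.TTheory GRing.Theory Num.Theory.
Import numFieldNormedType.Exports.

Local Open Scope ring_scope.

Section InnerProduct.
Variables (R : realType) (n : nat).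
Local Open Scope sesquilinear_scope.
Implicit Types (B : 'M[R[i]]_n) (u v w : 'cV[R[i]]_n) (mu : R[i]).

Lemma inner_adjointE u w : inner u w = (w ^t* *m u) 0 0.
Proof. by rewrite mxE; apply: eq_bigr => k _; rewrite !mxE mulrC. Qed.

Lemma inner_left_eigenvector B mu u w :
  left_eigenvector B mu w -> inner (B *m u) w = mu * inner u w.
Proof.
by case=> _ wB; rewrite !inner_adjointE mulmxA wB -scalemxAl mxE.
Qed.

Lemma inner_delta w k : inner (delta_mx k 0) w = Num.conj (w k 0).
Proof.
rewrite /inner (bigD1 k) //= big1 ?addr0 => [|j /negbTE jk].
  by rewrite mxE !eqxx mul1r.
by rewrite mxE jk mul0r.
Qed.

(** Both eigenvalues of [B] can be pulled out of [<B v, w>], so they agree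
    unless [<v, w>] vanishes. *)
Lemma eigenvectors_orthogonal B mu nu v w :
  right_eigenvector B mu v -> left_eigenvector B nu w -> mu != nu ->
  inner v w = 0.
Proof.
move=> [_ Bv] wB neq_mu_nu.
have inner_scale : inner (mu *: v) w = mu * inner v w.
  by rewrite !inner_adjointE -scalemxAr mxE.
have /eqP := inner_left_eigenvector v wB.
rewrite Bv inner_scale -subr_eq0 -mulrBl mulf_eq0 subr_eq0.
by rewrite (negbTE neq_mu_nu) => /eqP.
Qed.

Lemma normalized_eigenvectors_biorthogonal B (mu : 'I_n -> R[i])
    (w v : 'I_n -> 'cV[R[i]]_n) :
  (forall i, left_eigenvector B (mu i) (w i)) ->
  (forall i, right_eigenvector B (mu i) (v i)) ->
  normalized_eigenvectors mu w v ->
  forall i j, inner (v i) (w j) = (i == j)%:R.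
Proof.
move=> wB Bv norm_wv i j; have [/norm_wv //|neq_mu] := eqVneq (mu i) (mu j).
rewrite (eigenvectors_orthogonal (Bv i) (wB j) neq_mu).
by case: (eqVneq i j) neq_mu => // ->; rewrite eqxx.
Qed.

(** Biorthogonality says that the matrix with rows [w_i^*] is a left inverse of
    the matrix with columns [v_i]; as both are square it is a right inverse too,
    which is the completeness of the [v_i]. *)
Lemma biorthogonal_expansion (w v : 'I_n -> 'cV[R[i]]_n) :
  (forall i j, inner (v i) (w j) = (i == j)%:R) ->
  forall x, x = \sum_(i < n) inner x (w i) *: v i.
Proof.
move=> wv x.
pose W : 'M[R[i]]_n := \matrix_(i, k) Num.conj (w i k 0).
pose V : 'M[R[i]]_n := \matrix_(k, i) v i k 0.
have WE y i : (W *m y) i 0 = inner y (w i).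
  by rewrite mxE; apply: eq_bigr => k _; rewrite mxE mulrC.
have WV1 : W *m V = 1%:M.
  apply/matrixP => i j; rewrite !mxE eq_sym -wv.
  by apply: eq_bigr => k _; rewrite !mxE mulrC.
have VW1 := mulmx1C WV1.
rewrite -[LHS]mul1mx -VW1 -mulmxA; apply/matrixP => k j.
rewrite ord1 mxE summxE; apply: eq_bigr => i _.
by rewrite WE !mxE mulrC.
Qed.

End InnerProduct.

Section LinearFlow.
Variables (R : realType) (n : nat) (A : R -> 'M[R]_n).

Lemma solution_solves (t0 : R) x0 :
  well_posed A t0 -> solves_from A t0 x0 (solution A t0 x0).
Proof.
move=> wp; apply: (@xgetPex _ _ (fun x => solves_from A t0 x0 x)).
by have [x [xP _]] := wp x0; exists x.
Qed.

Lemma solves_from_solution (t0 : R) x0 x :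
  well_posed A t0 -> solves_from A t0 x0 x -> x = solution A t0 x0.
Proof.
move=> wp xP; have [y [_ y_uniq]] := wp x0.
by rewrite -(y_uniq _ xP); apply/y_uniq/solution_solves.
Qed.

Lemma is_solution_lincomb m (c : 'I_m -> R) (x : 'I_m -> R -> 'cV[R]_n) :
  (forall j, is_solution A (x j)) ->
  is_solution A (\sum_(j < m) (c j \*: x j)).
Proof.
move=> xP s.
have dx j : is_derive s 1 (c j \*: x j) (c j *: (A s *m x j s)).
  by apply: is_deriveZ; exact: xP.
have := is_derive_sum dx; congr (is_derive _ _ _ _).
rewrite fct_sumE mulmx_sumr; apply: eq_bigr => j _.
by rewrite -scalemxAr.
Qed.

(** By superposition and uniqueness, the solution issued from
    [x0 = \sum_j x0_j e_j] is the same combination of the solutions issued from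
    the [e_j], which are the columns of the fundamental matrix. *)
Lemma solution_fundamental_matrix (t t0 : R) x0 :
  well_posed A t0 -> solution A t0 x0 t = fundamental_matrix A t t0 *m x0.
Proof.
move=> wp; pose e j : 'cV[R]_n := delta_mx j 0.
have solE : \sum_(j < n) (x0 j 0 \*: solution A t0 (e j)) = solution A t0 x0.
  apply: solves_from_solution => //; split.
    by apply: is_solution_lincomb => j; have [] := solution_solves (e j) wp.
  rewrite fct_sumE [RHS]matrix_sum_delta; apply: eq_bigr => j _.
  by rewrite big_ord1 /=; have [_ ->] := solution_solves (e j) wp.
rewrite -solE fct_sumE; apply/matrixP => i k; rewrite ord1 summxE mxE.
by apply: eq_bigr => j _; rewrite !mxE mulrC.
Qed.

Lemma complexify_solution (t t0 : R) x0 :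
  well_posed A t0 ->
  complexify (solution A t0 x0 t) =
    complexify (fundamental_matrix A t t0) *m complexify x0.
Proof.
by move=> wp; rewrite (solution_fundamental_matrix t) // /complexify map_mxM.
Qed.

(** Nonvanishing has to be witnessed by a real state: if [w k 0 != 0], the basis
    vector [e_k] is one. *)
Lemma left_eigenvector_koopman_eigenpair (t t0 : R) mu lambda w :
  well_posed A t0 ->
  left_eigenvector (complexify (fundamental_matrix A t t0)) mu w ->
  mu = cexp lambda ->
  koopman_eigenpair A t t0 lambda (fun x => inner (complexify x) w).
Proof.
move=> wp wM muE; split=> [|x0]; last first.
  rewrite /koopman complexify_solution // -muE.
  exact: inner_left_eigenvector wM.
have /cV0Pn[k wk] : w != 0 by case: wM.
exists (delta_mx k 0); rewrite /complexify map_delta_mx inner_delta.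
by rewrite conjC_eq0.
Qed.

End LinearFlow.

Theorem proposition1 (R : realType) (n : nat) (A : R -> 'M[R]_n) (t t0 : R)
  (mu lambda : 'I_n -> R[i]) (w v : 'I_n -> 'cV[R[i]]_n) :
  well_posed A t0 ->
  (forall i, left_eigenvector (complexify (fundamental_matrix A t t0))
               (mu i) (w i)) ->
  (forall i, right_eigenvector (complexify (fundamental_matrix A t t0))
               (mu i) (v i)) ->
  (forall i, mu i = cexp (lambda i)) ->
  let phi : 'I_n -> 'cV[R]_n -> R[i] :=
    fun i x => inner (complexify x) (w i) in
  (forall i, koopman_eigenpair A t t0 (lambda i) (phi i)) /\
  (normalized_eigenvectors mu w v ->
     koopman_modes A t t0 (@full_state R n) lambda phi v /\
     forall (x0 : 'cV[R]_n) (x : R -> 'cV[R]_n),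
       solves_from A t0 x0 x ->
       complexify (x t) = koopman A t t0 (@full_state R n) x0 /\
       koopman A t t0 (@full_state R n) x0 =
         \sum_(i < n) (cexp (lambda i) * phi i x0) *: v i).
Proof.
move=> wp wM Mv muE phi.
have eigen i : koopman_eigenpair A t t0 (lambda i) (phi i).
  exact: left_eigenvector_koopman_eigenpair wp (wM i) (muE i).
split=> // norm_wv.
have expand (x0 : 'cV[R]_n) : complexify x0 = \sum_(i < n) phi i x0 *: v i.
  apply: biorthogonal_expansion.
  exact: normalized_eigenvectors_biorthogonal wM Mv norm_wv.
split; first by split.
move=> x0 x /(solves_from_solution wp) ->; split=> //.
rewrite /koopman /full_state complexify_solution // expand mulmx_sumr.
apply: eq_bigr => i _; have [_ Mvi] := Mv i.
by rewrite -scalemxAr Mvi scalerA mulrC muE.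
Qed.
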